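(* Consider the investment model, a horizon $m$ (a positive integer), and a policy set $\mathcal{U}$ as in the context. Let $\mathcal{V}_t(X)=\mathcal{E}(V^X_{t+m}|\mathcal{F}_t)$ and $\tilde{\mathcal{V}}_t(X)=\mathcal{E}(V^X_T|\mathcal{F}_t)$, where $\mathcal{E}$ is an $\mathcal{F}_t$-consistent nonlinear expectation. (1) Any $\tilde{\mathcal{U}}$-optimal solution $\{X^t\}$ to the modified moving horizon problem with horizon $m$ is dependable: with $\hat X_u=X^u_u$, for every $t\in\{0,\dots,T\}$, $$\tilde{\mathcal{V}}_t(X^t)\le\tilde{\mathcal{V}}_t(\hat X)\quad\mathbb{P}\text{-a.s.}$$ (2) If $\mathcal{U}$ is closed under truncation (for the horizon $m$), then the modified moving horizon problem gives the same values and policy choices at all times as the simple moving horizon problem. That is, for every $t$ and every past policy $\hat X\in\mathcal{U}$: $\tilde{\mathcal{V}}_t(X)=\mathcal{V}_t(X)$ $\mathbb{P}$-a.s. for all $X\in\tilde{\mathcal{U}}|_t^{\hat X}$; a policy $X\in\tilde{\mathcal{U}}|_t^{\hat X}$ uniformly maximises $\tilde{\mathcal{V}}_t$ on $\tilde{\mathcal{U}}|_t^{\hat X}$ if and only if it uniformly maximises $\mathcal{V}_t$ on $\mathcal{U}|_t^{\hat X}$; and if $X\in\mathcal{U}|_t^{\hat X}$ uniformly maximises $\mathcal{V}_t$ on $\mathcal{U}|_t^{\hat X}$, then so does its truncation $I_{[0,t+m[}X\in\tilde{\mathcal{U}}|_t^{\hat X}$.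
   Context: Model. Time is $\{0,1,\dots,T\}$; $(\Omega,\mathcal{F},\{\mathcal{F}_t\},\mathbb{P})$ is a complete filtered probability space; $\mathbf{S}$ is an $\mathbb{R}^d$-valued adapted price process with $\mathbf{S}_t\in L^2(\mathcal{F}_t)$ for all $t$; the interest rate is zero. Policies are adapted $\mathbb{R}^d$-valued processes $X=(X_t)_{0\le t\le T}$, identified when $\mathbb{P}$-a.s. equal at each time; the set $\mathcal{U}$ of available policies is a compact subset of $\{X: X_t\in L^2(\mathbb{R}^d;\mathcal{F}_t)\ \forall t\}$. The wealth process satisfies $V^X_{t+1}=V^X_t+\langle X_t,\mathbf{S}_{t+1}-\mathbf{S}_t\rangle$ for $t<T$ from a given initial wealth $V_0$ (the same for all policies), and $V^X_u:=V^X_T$ for $u>T$. Nonlinear expectation. An $\mathcal{F}_t$-consistent nonlinear expectation is a system of operators $\mathcal{E}(\cdot|\mathcal{F}_t):L^1(\mathcal{F}_T)\to L^1(\mathcal{F}_t)$ such that: (monotonicity) $Q\ge Q'$ a.s. implies $\mathcal{E}(Q|\mathcal{F}_t)\ge\mathcal{E}(Q'|\mathcal{F}_t)$ a.s., with $\mathcal{E}(Q|\mathcal{F}_t)=\mathcal{E}(Q'|\mathcal{F}_t)$ only if $Q=Q'$ a.s.; (constant invariance) $\mathcal{E}(Q|\mathcal{F}_t)=Q$ for $Q\in L^1(\mathcal{F}_t)$; (recursivity) $\mathcal{E}(\mathcal{E}(Q|\mathcal{F}_t)|\mathcal{F}_s)=\mathcal{E}(Q|\mathcal{F}_s)$ a.s.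 for $s\le t$; (zero-one law) $I_A\mathcal{E}(Q|\mathcal{F}_t)=\mathcal{E}(I_AQ|\mathcal{F}_t)$ for $A\in\mathcal{F}_t$. Policy spaces. For $\hat X\in\mathcal{U}$, $\mathcal{U}|_t^{\hat X}=\{X'\in\mathcal{U}:X'_s=\hat X_s\ \mathbb{P}\text{-a.s. for all }s<t\}$. The truncation $I_{[0,t+m[}X$ is the process equal to $X_u$ for $u<t+m$ and to $0$ for $u\ge t+m$. Set $\tilde{\mathcal{U}}|_t^{\hat X}:=I_{[0,t+m[}\mathcal{U}|_t^{\hat X}=\{I_{[0,t+m[}X: X\in\mathcal{U}|_t^{\hat X}\}$. $\mathcal{U}$ is closed under truncation (for horizon $m$) if $I_{[0,t+m[}\mathcal{U}|_t^{\hat X}\subseteq\mathcal{U}|_t^{\hat X}$ for all $t$ and all $\hat X\in\mathcal{U}$. Standing assumption (standard problem): $\mathcal{U}$ is compact; for all $t$ and $\hat X\in\mathcal{U}$, both $\mathcal{U}|_t^{\hat X}$ and $\tilde{\mathcal{U}}|_t^{\hat X}$ satisfy the pasting property: $I_AX+I_{A^c}X'$ belongs to the set whenever $X,X'$ do and $A\in\mathcal{F}_t$; and the value functions are lower semicontinuous in the sense that if $X^n\to X^\infty$ and the values $\mathcal{V}_t(X^n)$ are a.s. nondecreasing in $n$ then they converge to $\mathcal{V}_t(X^\infty)$ (likewise for $\tilde{\mathcal{V}}_t$). Policy choices. A policy choice is a collection $\{X^t\}_{0\le t\le T}$ with $X^t\in\mathcal{U}$; its realised policy is $\hat X_u:=X^u_u$.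 It is viable if $X^t\in\mathcal{U}|_t^{\hat X}$ for every $t$ (equivalently $X^t\in\mathcal{U}|_t^{X^{t-1}}$ for $t\ge1$); then $\hat X=X^T\in\mathcal{U}$. A policy uniformly maximises a function $W$ on a set of policies if it belongs to the set and its $W$-value is $\mathbb{P}$-a.s. at least that of every element of the set. Problems. The simple moving horizon problem with horizon $m$ is to find a viable $\{X^t\}$ such that, for each $t$, $X^t$ uniformly maximises $\mathcal{V}_t$ on $\mathcal{U}|_t^{\hat X}$. The modified moving horizon problem with horizon $m$ is to find a viable $\{X^t\}$ such that, for each $t$, $X^t\in\tilde{\mathcal{U}}|_t^{\hat X}$ and $X^t$ uniformly maximises $\tilde{\mathcal{V}}_t$ on $\tilde{\mathcal{U}}|_t^{\hat X}$; such a collection is called a $\tilde{\mathcal{U}}$-optimal solution. *)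

(* Defs.v *)
From HB Require Import structures.
From mathcomp Require Import all_boot all_order all_algebra.
From mathcomp Require Import all_classical all_reals all_analysis.
From mathcomp Require Import measurable_realfun.

Set Implicit Arguments.
Unset Strict Implicit.
Unset Printing Implicit Defensive.

Import Order.TTheory GRing.Theory Num.Theory.
Import numFieldNormedType.Exports.
Local Open Scope classical_set_scope.
Local Open Scope ring_scope.

Notation "f <= g %[as P ]" := (\forall w \ae P, f w <= g w)
  (at level 70, g at next level, format "f  <=  g  %[as  P ]").

(* The set of times {0, ..., T} is 'I_T.+1. *)
Record complete_filtration (disp : measure_display)
    (Omega : measurableType disp) (R : realType) (P : probability Omega R)
    (T : nat) := CompleteFiltration {
  filtration_set :> 'I_T.+1 -> set_system Omega ;
  filtration_sigma_algebra : forall t, sigma_algebra setT (filtration_set t) ;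
  filtration_measurable : forall t, filtration_set t `<=` measurable ;
  filtration_nondecreasing : forall s t : 'I_T.+1, (s <= t)%N ->
    filtration_set s `<=` filtration_set t ;
  filtration_complete_measure : measure_is_complete P ;
  filtration_negligible : P.-negligible `<=` filtration_set ord0 }.

(* Representatives of the elements of L^p(G), for a sub-sigma-algebra G. *)
Definition sub_Lfun (disp : measure_display) (Omega : measurableType disp)
    (R : realType) (P : probability Omega R) (p : \bar R)
    (G : set_system Omega) (f : Omega -> R) : Prop :=
  (forall B : set R, measurable B -> G (f @^-1` B)) /\ f \in Lfun P p.

Section L2process.
Context (disp : measure_display) (Omega : measurableType disp) (R : realType).
Context (P : probability Omega R) (T : nat) (F : complete_filtration P T).
Context (d : nat).

Record L2process := MkL2process {
  process_val :> 'I_T.+1 -> Omega -> 'rV[R]_d ;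
  process_L2 : forall t i,
    sub_Lfun P 2%:E (F t) (fun w => process_val t w 0 i) }.

HB.instance Definition _ := gen_eqMixin L2process.
HB.instance Definition _ := gen_choiceMixin L2process.

(* The maximum over t and i of the L^2 distances between the coordinates
   induces the topology of L^2 convergence at every time. As processes are
   not quotiented by almost sure equality, it is only a pseudometric. *)
Definition L2ball (X : L2process) (e : R) : set L2process :=
  [set Y : L2process | forall t i,
    ('N[P]_2%:E[EFin \o (fun w => X t w 0 i - Y t w 0 i)%R] < e%:E)%E].

Lemma L2process_mfun (X : L2process) t i :
  measurable_fun [set: Omega] (fun w => X t w 0 i).
Proof. by have [_ /sub_Lfun_mfun] := process_L2 X t i; rewrite inE. Qed.

Lemma L2ball_center (X : L2process) (e : R) : 0 < e -> L2ball X e X.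
Proof.
move=> e0 t i /=; rewrite [X in 'N[_]__[X]%E](_ : _ = cst 0%E).
  by rewrite Lnorm0 ?lte_fin// eqe pnatr_eq0.
by apply/funext => w /=; rewrite subrr.
Qed.

Lemma L2ball_sym (X Y : L2process) (e : R) : L2ball X e Y -> L2ball Y e X.
Proof.
move=> XY t i; have := XY t i; rewrite -oppe_Lnorm; congr (_ < _)%E.
by congr Lnorm; apply/funext => w /=; rewrite opprB.
Qed.

Lemma L2ball_triangle (X Y Z : L2process) (e1 e2 : R) :
  L2ball X e1 Y -> L2ball Y e2 Z -> L2ball X (e1 + e2) Z.
Proof.
move=> XY YZ t i; rewrite EFinD.
apply: le_lt_trans (lteD (XY t i) (YZ t i)).
rewrite [X in ('N[_]__[X] <= _)%E](_ : _ = EFin \o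
  ((fun w => X t w 0 i - Y t w 0 i) \+ (fun w => Y t w 0 i - Z t w 0 i))).
  by apply: minkowski_EFin; rewrite ?lerDl//; apply: measurable_funB;
    exact: L2process_mfun.
by apply/funext => w /=; rewrite addrA subrK.
Qed.

HB.instance Definition _ :=
  hasNbhs.Build L2process (nbhs_ (entourage_ L2ball)).

HB.instance Definition _ := Nbhs_isPseudoMetric.Build R L2process
  erefl L2ball_center L2ball_sym L2ball_triangle erefl.

Definition process_aeq (X Y : L2process) : Prop :=
  forall t, X t = Y t %[ae P].

Lemma truncate_subproof (X : L2process) (n : nat) t i :
  sub_Lfun P 2%:E (F t) (fun w => (if (t < n)%N then X t w else 0) 0 i).
Proof.
case: (t < n)%N; first exact: process_L2.
rewrite (_ : (fun _ => _) = cst 0); last by apply/funext => w; rewrite mxE.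
split; last exact: Lfun_cst.
have [F0 FC _] := filtration_sigma_algebra F t.
move=> B _; rewrite preimage_cst; case: ifP => _ //.
by have := FC _ F0; rewrite setD0.
Qed.

Definition truncate (X : L2process) (n : nat) : L2process :=
  MkL2process (truncate_subproof X n).

Definition realised (X : 'I_T.+1 -> L2process) : L2process :=
  @MkL2process (fun u => X u u) (fun u => process_L2 (X u) u).

End L2process.

(* The operators are given on representatives; monotonicity makes them
   compatible with almost sure equality. *)
Record nonlinear_expectation (disp : measure_display)
    (Omega : measurableType disp) (R : realType) (P : probability Omega R)
    (T : nat) (F : complete_filtration P T)
    (E : 'I_T.+1 -> (Omega -> R) -> Omega -> R) : Prop := {
  nlexp_L1 : forall t Q, sub_Lfun P 1%:E (F ord_max) Q ->
    sub_Lfun P 1%:E (F t) (E t Q) ;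
  nlexp_monotone : forall t Q Q',
    sub_Lfun P 1%:E (F ord_max) Q -> sub_Lfun P 1%:E (F ord_max) Q' ->
    Q' <= Q %[as P] -> E t Q' <= E t Q %[as P] ;
  nlexp_strict : forall t Q Q',
    sub_Lfun P 1%:E (F ord_max) Q -> sub_Lfun P 1%:E (F ord_max) Q' ->
    Q' <= Q %[as P] -> E t Q = E t Q' %[ae P] -> Q = Q' %[ae P] ;
  nlexp_const : forall t Q, sub_Lfun P 1%:E (F t) Q -> E t Q = Q %[ae P] ;
  nlexp_recursive : forall (s t : 'I_T.+1) Q, (s <= t)%N ->
    sub_Lfun P 1%:E (F ord_max) Q -> E s (E t Q) = E s Q %[ae P] ;
  nlexp_zero_one : forall t A Q, F t A -> sub_Lfun P 1%:E (F ord_max) Q ->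
    \1_A \* E t Q = E t (\1_A \* Q) %[ae P] }.

Section moving_horizon.
Context (disp : measure_display) (Omega : measurableType disp) (R : realType).
Context (P : probability Omega R) (T : nat) (F : complete_filtration P T).
Context (d : nat).
Local Notation process := (L2process F d).
Implicit Types (U W : set process) (X Y : process) (t : 'I_T.+1) (m : nat).

(* u ranges over nat, to allow u > T; inord n is the time n, as n < T. *)
Fixpoint wealth (S : process) (V0 : Omega -> R) X (u : nat) : Omega -> R :=
  if u is n.+1 then
    if (n < T)%N then fun w => wealth S V0 X n w +
      \sum_(i < d) X (inord n) w 0 i * (S (inord n.+1) w 0 i - S (inord n) w 0 i)
    else wealth S V0 X n
  else V0.

Section values.
Context (E : 'I_T.+1 -> (Omega -> R) -> Omega -> R).
Context (S : process) (V0 : Omega -> R).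

Definition value m t X : Omega -> R := E t (wealth S V0 X (t + m)).

Definition value_tilde t X : Omega -> R := E t (wealth S V0 X T).

End values.

Definition past_set U t (Xh : process) : set process :=
  [set X | U X /\ forall s : 'I_T.+1, (s < t)%N -> X s = Xh s %[ae P]].

(* The image of past_set under truncation, saturated for almost sure equality
   since processes are representatives. *)
Definition trunc_past_set U m t (Xh : process) : set process :=
  [set Y | exists2 X, past_set U t Xh X & process_aeq Y (truncate X (t + m))].

Definition closed_under_truncation U m : Prop :=
  forall t Xh, U Xh -> trunc_past_set U m t Xh `<=` past_set U t Xh.

(* Existence of Z: the pasted process is only almost surely equal to an adapted
   one at times s < t, where X and X' agree almost surely but A need not be in
   F s. *)
Definition pasting t W : Prop :=
  forall X X' (A : set Omega), W X -> W X' -> F t A ->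
    exists2 Z : process, W Z &
      forall s, Z s = (fun w => if w \in A then X s w else X' s w) %[ae P].

Definition lower_semicontinuous_on W (v : process -> Omega -> R) : Prop :=
  forall (X : nat -> process) (Xoo : process),
    (forall n, W (X n)) -> W Xoo -> X @ \oo --> Xoo ->
    (forall n, v (X n) <= v (X n.+1) %[as P]) ->
    \forall w \ae P, v (X n) w @[n --> \oo] --> v Xoo w.

Definition uniformly_maximises (v : process -> Omega -> R) W X : Prop :=
  W X /\ forall Y, W Y -> v Y <= v X %[as P].

Definition viable U (X : 'I_T.+1 -> process) : Prop :=
  forall t, past_set U t (realised X) (X t).

Section problem.
Context (E : 'I_T.+1 -> (Omega -> R) -> Omega -> R).
Context (S : process) (V0 : Omega -> R).

Record standard_problem U m : Prop := {
  (* policies are identified when almost surely equal at each time *)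
  policies_aeq : forall X Y, U X -> process_aeq X Y -> U Y ;
  policies_compact : compact U ;
  policies_pasting : forall t Xh, U Xh -> pasting t (past_set U t Xh) ;
  trunc_policies_pasting : forall t Xh, U Xh ->
    pasting t (trunc_past_set U m t Xh) ;
  value_lsc : forall t Xh, U Xh ->
    lower_semicontinuous_on (past_set U t Xh) (value E S V0 m t) ;
  value_tilde_lsc : forall t Xh, U Xh ->
    lower_semicontinuous_on (trunc_past_set U m t Xh) (value_tilde E S V0 t) }.

Definition modified_moving_horizon_solution U m (X : 'I_T.+1 -> process) :=
  viable U X /\
  forall t, uniformly_maximises (value_tilde E S V0 t)
    (trunc_past_set U m t (realised X)) (X t).

End problem.

End moving_horizon.

(* Main.v *)
Require Import Defs.
From HB Require Import structures.
From mathcomp Require Import all_boot all_order all_algebra.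
From mathcomp Require Import all_classical all_reals all_analysis.
From mathcomp Require Import measurable_realfun.

Set Implicit Arguments.
Unset Strict Implicit.
Unset Printing Implicit Defensive.

Import Order.TTheory GRing.Theory Num.Theory.
Import numFieldNormedType.Exports.
Local Open Scope classical_set_scope.
Local Open Scope ring_scope.

(** (1) The policy chosen at time [t] vanishes from [t + m] on, hence remains
    admissible at time [t + 1], so the values at time [t + 1] of the successive choices
    increase; recursivity and monotonicity of the expectation carry this back to
    time [t], and the last choice is almost surely the realised policy.
    (2) The wealth at time [t + m] only sees the policy before [t + m], and the
    wealth of a policy truncated at [t + m] is frozen from then on: the terminal
    wealth of a truncation is the wealth at [t + m] of the original policy. *)

(** * Integrable functions measurable for a sub-sigma-algebra *)

Section sub_Lfun_theory.
Context {disp : measure_display} {Omega : measurableType disp} {R : realType}.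
Context {P : probability Omega R}.
Implicit Types (G H : set_system Omega) (f g : Omega -> R) (p : \bar R).

(** A sigma-algebra equals the one it generates, so measurability for the bare set system [G]
    becomes ordinary measurability on a measurable type, where the usual closure lemmas apply. *)
Lemma sub_measurableP G f : sigma_algebra setT G ->
  (forall B : set R, measurable B -> G (f @^-1` B)) <->
  measurable_fun setT (f : g_sigma_algebraType G -> R).
Proof.
move=> sG; split=> [fG _ B mB|mf B mB].
  by rewrite setTI; apply: sub_sigma_algebra; exact: fG.
have := mf measurableT B mB.
by rewrite setTI /measurable /= sigma_algebra_id.
Qed.

Lemma sub_Lfun_subset G H p f : G `<=` H ->
  sub_Lfun P p G f -> sub_Lfun P p H f.
Proof. by move=> GH [fG fp]; split => // B /fG /GH. Qed.

Context (G : set_system Omega).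
Hypothesis sG : sigma_algebra setT G.

Lemma sub_Lfun_cst0 p : (1 <= p)%E -> sub_Lfun P p G (cst 0).
Proof.
move=> p1; split; last by have [+ _] := Lfun_addr_closed P p1.
by apply/(sub_measurableP _ sG); exact: measurable_cst.
Qed.

Lemma sub_LfunD p f g : (1 <= p)%E ->
  sub_Lfun P p G f -> sub_Lfun P p G g -> sub_Lfun P p G (f \+ g).
Proof.
move=> p1 [fG fp] [gG gp]; split.
  apply/(sub_measurableP _ sG).
  by apply: measurable_funD; exact/(sub_measurableP _ sG).
by have [_ +] := Lfun_addr_closed P p1; exact.
Qed.

Lemma sub_LfunB p f g : (1 <= p)%E ->
  sub_Lfun P p G f -> sub_Lfun P p G g -> sub_Lfun P p G (f \- g).
Proof.
move=> p1 fGp [gG gp]; apply: sub_LfunD => //; split.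
  by apply/(sub_measurableP _ sG)/measurableT_comp => //; exact/(sub_measurableP _ sG).
exact: (Lfun_oppr_closed gp).
Qed.

Lemma sub_Lfun_sum (I : Type) (r : seq I) p (f : I -> Omega -> R) : (1 <= p)%E ->
  (forall i, sub_Lfun P p G (f i)) ->
  sub_Lfun P p G (fun w => \sum_(i <- r) f i w).
Proof.
move=> p1 fGp; elim: r => [|i r IHr].
  under eq_fun do rewrite big_nil; exact: sub_Lfun_cst0.
under eq_fun do rewrite big_cons; exact: sub_LfunD.
Qed.

(** By Hölder, a gain, being a product of a position and a price increment both in L^2, is in L^1,
    the domain of the expectation. *)
Lemma sub_Lfun2M f g :
  sub_Lfun P 2%:E G f -> sub_Lfun P 2%:E G g -> sub_Lfun P 1%:E G (f \* g).
Proof.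
move=> [fG f2] [gG g2]; split; last exact: Lfun2_mul_Lfun1.
by apply/(sub_measurableP _ sG)/measurable_funM; exact/(sub_measurableP _ sG).
Qed.

End sub_Lfun_theory.

(** * Integrability, locality and truncation of wealth *)

Section wealth_theory.
Context {disp : measure_display} {Omega : measurableType disp} {R : realType}.
Context {P : probability Omega R} {T : nat} {F : complete_filtration P T}.
Context {d : nat} (S : L2process F d) (V0 : Omega -> R).
Implicit Types (X Y : L2process F d) (t : 'I_T.+1).

Lemma filtration_sub_max t : F t `<=` F ord_max.
Proof. by apply: filtration_nondecreasing; rewrite -ltnS. Qed.

Lemma wealth_sub_Lfun X u : sub_Lfun P 1%:E (F ord0) V0 ->
  sub_Lfun P 1%:E (F ord_max) (wealth S V0 X u).
Proof.
move=> V0L; have sF := filtration_sigma_algebra F ord_max.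
have L2 (Y : L2process F d) t i : sub_Lfun P 2%:E (F ord_max) (fun w => Y t w 0 i).
  exact: sub_Lfun_subset (@filtration_sub_max _) (process_L2 Y t i).
elim: u => [|u IHu] /=; first exact: sub_Lfun_subset (@filtration_sub_max _) V0L.
case: ifP => // _; apply: (sub_LfunD sF) => //.
apply: (sub_Lfun_sum sF) => // i; apply: (sub_Lfun2M sF) => //.
by apply: (sub_LfunB sF) => //; rewrite lee_fin ler1n.
Qed.

Lemma wealth_after_T X u : (T <= u)%N -> wealth S V0 X u = wealth S V0 X T.
Proof.
move=> /subnK <-; elim: (u - T)%N => //= n ->.
by rewrite ltnNge leq_addl.
Qed.

Lemma wealth_ae_eq X Y u :
  (forall t, (t < u)%N -> X t = Y t %[ae P]) ->
  wealth S V0 X u = wealth S V0 Y u %[ae P].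
Proof.
elim: u => [|u IHu] XY /=; first exact: ae_eq_refl.
have {IHu}Wu : wealth S V0 X u = wealth S V0 Y u %[ae P].
  by apply: IHu => t tu; apply: XY; rewrite ltnW.
case: ifP => // uT.
(* As [u < T], [inord u] is really the time [u] and not the default ordinal. *)
have Xu : X (inord u) = Y (inord u) %[ae P] by apply: XY; rewrite inordK // ltnW.
by apply: filterS2 Wu Xu => w /= Wu Xu _; rewrite Wu // Xu.
Qed.

Lemma wealth_truncate_before X n u : (u <= n)%N ->
  wealth S V0 (truncate X n) u = wealth S V0 X u.
Proof.
elim: u => //= u IHu un; rewrite (IHu (ltnW un)); case: ifP => // uT.
by rewrite inordK ?un // ltnW.
Qed.

Lemma wealth_truncate_after X n u : (n <= u)%N ->
  wealth S V0 (truncate X n) u = wealth S V0 X n.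
Proof.
elim: u => [|u IHu]; first by rewrite leqn0 => /eqP ->.
rewrite leq_eqVlt => /predU1P[->|]; first exact: wealth_truncate_before.
rewrite ltnS => nu /=; rewrite (IHu nu); case: ifP => // uT.
(* At time [u >= n] the truncated position is zero, so every term of the gain vanishes. *)
apply/funext => w; rewrite big1 ?addr0 // => i _.
by rewrite inordK ?ltnNge ?nu ?mxE ?mul0r // ltnW.
Qed.

Lemma wealth_truncate_T X n :
  wealth S V0 (truncate X n) T = wealth S V0 X n.
Proof.
have [nT|Tn] := leqP n T; first exact: wealth_truncate_after.
(* If the truncation time exceeds [T], nothing is cut before [T], and wealth is constant after
   [T]. *)
by rewrite wealth_truncate_before ?(ltnW Tn)// (wealth_after_T _ (ltnW Tn)).
Qed.

End wealth_theory.

(** * Almost sure comparison under the nonlinear expectation *)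

Section nonlinear_expectation_theory.
Context {disp : measure_display} {Omega : measurableType disp} {R : realType}.
Context {P : probability Omega R} {T : nat} {F : complete_filtration P T}.
Context (E : 'I_T.+1 -> (Omega -> R) -> Omega -> R).
Hypothesis hE : nonlinear_expectation F E.
Implicit Types (t : 'I_T.+1) (Q : Omega -> R).

Lemma nlexp_ae_eq t Q Q' :
  sub_Lfun P 1%:E (F ord_max) Q -> sub_Lfun P 1%:E (F ord_max) Q' ->
  Q = Q' %[ae P] -> E t Q = E t Q' %[ae P].
Proof.
move=> QL Q'L QQ'.
have le1 : E t Q' <= E t Q %[as P].
  by apply: (nlexp_monotone hE) => //; apply: filterS QQ' => w ->.
have le2 : E t Q <= E t Q' %[as P].
  by apply: (nlexp_monotone hE) => //; apply: filterS QQ' => w ->.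
by apply: filterS2 le1 le2 => w l1 l2 _; apply/eqP; rewrite eq_le l1 l2.
Qed.

(** Apply [E s] to the inequality at time [t], then collapse [E s (E t _)] to [E s _] by
    recursivity. *)
Lemma nlexp_le_tower (s t : 'I_T.+1) Q Q' : (s <= t)%N ->
  sub_Lfun P 1%:E (F ord_max) Q -> sub_Lfun P 1%:E (F ord_max) Q' ->
  E t Q' <= E t Q %[as P] -> E s Q' <= E s Q %[as P].
Proof.
move=> st QL Q'L.
have EL Z : sub_Lfun P 1%:E (F ord_max) Z -> sub_Lfun P 1%:E (F ord_max) (E t Z).
  by move=> /(nlexp_L1 hE t); exact/sub_Lfun_subset/filtration_sub_max.
move=> /(nlexp_monotone hE s (EL _ QL) (EL _ Q'L)) le_st.
have rQ := nlexp_recursive hE st QL; have rQ' := nlexp_recursive hE st Q'L.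
by apply: filterS3 le_st rQ rQ' => w + <- // <-.
Qed.

End nonlinear_expectation_theory.

(** * Dependability of solutions to the modified problem *)

Section dependability.
Context {disp : measure_display} {Omega : measurableType disp} {R : realType}.
Context {P : probability Omega R} {T d : nat} {F : complete_filtration P T}.
Context (S : L2process F d) (V0 : Omega -> R).
Hypothesis hV0 : sub_Lfun P 1%:E (F ord0) V0.
Context (E : 'I_T.+1 -> (Omega -> R) -> Omega -> R).
Hypothesis hE : nonlinear_expectation F E.
Context (m : nat) (U : set (L2process F d)).

(** The witness is [Y] itself: it vanishes almost surely from [s + m] on, so truncating it one step
    later changes nothing, and the agreement at [s] extends the common past to all times before
    [t]. *)
Lemma trunc_past_set_next (Xh Y : L2process F d) (s t : 'I_T.+1) :
  t = s.+1 :> nat -> past_set U s Xh Y -> Y s = Xh s %[ae P] ->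
  trunc_past_set U m s Xh Y -> trunc_past_set U m t Xh Y.
Proof.
move=> ts [UY Ypast] Ys [X _ YX]; exists Y; first split => // r.
  rewrite ts ltnS leq_eqVlt => /predU1P[rs|]; last exact: Ypast.
  by rewrite (_ : r = s) //; exact: val_inj.
move=> u /=; case: ltnP => [_|tmu]; first exact: ae_eq_refl.
have /= := YX u; case: ltnP => // + _; rewrite ltnNge ltnW //.
by rewrite -addSn -ts.
Qed.

(** Induction on [t]: the choice at [n] competes at [n.+1] with the optimal choice there, and the
    tower property moves this comparison back to [s]. *)
Lemma modified_solution_le (X : 'I_T.+1 -> L2process F d) (s t : 'I_T.+1) :
  modified_moving_horizon_solution E S V0 U m X -> (s <= t)%N ->
  value_tilde E S V0 s (X s) <= value_tilde E S V0 s (X t) %[as P].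
Proof.
move=> [Xv Xmax]; have WL Y := wealth_sub_Lfun S Y T hV0.
case: t => n nT /=; elim: n nT => [|n IHn] nT.
  rewrite leqn0 => /eqP s0; rewrite (_ : s = Ordinal nT); last exact/val_inj.
  by apply: aeW => w.
rewrite leq_eqVlt => /predU1P[sn|sn].
  by rewrite (_ : s = Ordinal nT); [apply: aeW => w|exact/val_inj].
have nT' : (n < T.+1)%N by exact: ltnW.
have le_n := IHn nT' sn.
have le_Sn : value_tilde E S V0 s (X (Ordinal nT'))
    <= value_tilde E S V0 s (X (Ordinal nT)) %[as P].
  apply: (nlexp_le_tower hE (t := Ordinal nT)) => //=; first exact: ltnW.
  apply: (Xmax (Ordinal nT)).2; apply: (@trunc_past_set_next _ _ (Ordinal nT')).
  - by [].
  - exact: Xv.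
  - exact: ae_eq_refl.
  - exact: (Xmax (Ordinal nT')).1.
by apply: filterS2 le_n le_Sn => w; exact: le_trans.
Qed.

Lemma modified_solution_dependable (X : 'I_T.+1 -> L2process F d) (t : 'I_T.+1) :
  modified_moving_horizon_solution E S V0 U m X ->
  value_tilde E S V0 t (X t) <= value_tilde E S V0 t (realised X) %[as P].
Proof.
move=> Xsol; have WL Y := wealth_sub_Lfun S Y T hV0.
have le_T : value_tilde E S V0 t (X t) <= value_tilde E S V0 t (X ord_max) %[as P].
  by apply: modified_solution_le => //; rewrite -ltnS.
have eq_T : value_tilde E S V0 t (X ord_max) =
    value_tilde E S V0 t (realised X) %[ae P].
  (* Wealth at [T] only uses positions strictly before [T], where viability at the last time gives
     agreement with the realised policy. *)
  apply: (nlexp_ae_eq hE) => //; apply: wealth_ae_eq => s sT.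
  by have [_] := Xsol.1 ord_max; exact.
by apply: filterS2 le_T eq_T => w + <-.
Qed.

End dependability.

(** * The simple and modified problems under closure by truncation *)

Section closed_truncation.
Context {disp : measure_display} {Omega : measurableType disp} {R : realType}.
Context {P : probability Omega R} {T d : nat} {F : complete_filtration P T}.
Context (S : L2process F d) (V0 : Omega -> R).
Hypothesis hV0 : sub_Lfun P 1%:E (F ord0) V0.
Context (E : 'I_T.+1 -> (Omega -> R) -> Omega -> R).
Hypothesis hE : nonlinear_expectation F E.
Context (m : nat) (U : set (L2process F d)) (t : 'I_T.+1) (Xh : L2process F d).

Lemma value_truncate X :
  value E S V0 m t (truncate X (t + m)) = value E S V0 m t X.
Proof. by rewrite /value wealth_truncate_before. Qed.

Lemma trunc_past_set_truncate X : past_set U t Xh X ->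
  trunc_past_set U m t Xh (truncate X (t + m)).
Proof. by move=> XU; exists X => // s; exact: ae_eq_refl. Qed.

Lemma trunc_past_value X : trunc_past_set U m t Xh X ->
  value_tilde E S V0 t X = value E S V0 m t X %[ae P].
Proof.
move=> [Y _ XY]; have WL Z u := wealth_sub_Lfun S Z u hV0.
apply: (nlexp_ae_eq hE) => //.
have WT : wealth S V0 X T = wealth S V0 (truncate Y (t + m)) T %[ae P].
  by apply: wealth_ae_eq => s _; exact: XY.
have Wtm : wealth S V0 X (t + m) = wealth S V0 (truncate Y (t + m)) (t + m) %[ae P].
  by apply: wealth_ae_eq => s _; exact: XY.
(* Both wealths of [X] reduce to the wealth at [t + m] of the untruncated [Y]. *)
rewrite wealth_truncate_T in WT; rewrite wealth_truncate_before // in Wtm.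
by apply: filterS2 WT Wtm => w WT Wtm _; rewrite WT // Wtm.
Qed.

Hypothesis trunc_sub : trunc_past_set U m t Xh `<=` past_set U t Xh.

Lemma uniformly_maximises_truncate X :
  uniformly_maximises (value E S V0 m t) (past_set U t Xh) X ->
  trunc_past_set U m t Xh (truncate X (t + m)) /\
  uniformly_maximises (value E S V0 m t) (past_set U t Xh) (truncate X (t + m)).
Proof.
move=> [XU Xmax]; have tX := trunc_past_set_truncate XU; split => //; split.
  exact: trunc_sub.
by move=> Y /Xmax; rewrite value_truncate.
Qed.

Lemma uniformly_maximises_trunc_past X : trunc_past_set U m t Xh X ->
  uniformly_maximises (value_tilde E S V0 t) (trunc_past_set U m t Xh) X <->
  uniformly_maximises (value E S V0 m t) (past_set U t Xh) X.
Proof.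
move=> tX; have eX := trunc_past_value tX; split => -[_ Xmax]; split => //.
- exact: trunc_sub.
(* A competitor [Y] is replaced by its truncation, which has the same [value] and is admissible for
   the modified problem. *)
- move=> Y YU; have tY := trunc_past_set_truncate YU.
  have eY := trunc_past_value tY; rewrite value_truncate in eY.
  by apply: filterS3 (Xmax _ tY) eX eY => w + <- // <-.
(* Conversely, closure makes each truncated competitor a competitor in the simple problem, and the
   two values agree on it. *)
- move=> Y tY; have eY := trunc_past_value tY.
  by apply: filterS3 (Xmax _ (trunc_sub tY)) eX eY => w + -> // ->.
Qed.

End closed_truncation.

Theorem theorem3p1 (disp : measure_display) (Omega : measurableType disp)
    (R : realType) (P : probability Omega R) (T d : nat)
    (F : complete_filtration P T) (S : L2process F d)
    (V0 : Omega -> R) (hV0 : sub_Lfun P 1%:E (F ord0) V0)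
    (E : 'I_T.+1 -> (Omega -> R) -> Omega -> R)
    (hE : nonlinear_expectation F E)
    (m : nat) (hm : (0 < m)%N)
    (U : set (L2process F d)) (hU : standard_problem E S V0 U m) :
  (forall X : 'I_T.+1 -> L2process F d,
    modified_moving_horizon_solution E S V0 U m X ->
    forall t : 'I_T.+1,
      value_tilde E S V0 t (X t) <= value_tilde E S V0 t (realised X) %[as P])
  /\
  (closed_under_truncation U m ->
   forall (t : 'I_T.+1) (Xh : L2process F d), U Xh ->
   [/\ forall X, trunc_past_set U m t Xh X ->
         value_tilde E S V0 t X = value E S V0 m t X %[ae P],
       forall X, trunc_past_set U m t Xh X ->
         (uniformly_maximises (value_tilde E S V0 t)
            (trunc_past_set U m t Xh) X <->
          uniformly_maximises (value E S V0 m t) (past_set U t Xh) X) &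
       forall X, uniformly_maximises (value E S V0 m t) (past_set U t Xh) X ->
         trunc_past_set U m t Xh (truncate X (t + m)) /\
         uniformly_maximises (value E S V0 m t) (past_set U t Xh)
           (truncate X (t + m))]).
Proof.
split=> [X Xsol t|Ucl t Xh UXh].
  exact: (modified_solution_dependable hV0 hE _ Xsol).
have trunc_sub := Ucl t Xh UXh; split=> X.
- exact: (trunc_past_value _ hV0 hE).
- exact: (uniformly_maximises_trunc_past _ hV0 hE trunc_sub).
- exact: (uniformly_maximises_truncate trunc_sub).
Qed.
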